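(* Let $K$ be a number field and $\mathfrak p$ a prime of $K$ lying over the rational prime $p$. Let $\mu\in\mathbb Q$ and $\mathbf a=(a_1,\dots,a_r)$, $a_i\in K^{n\times n}$, be such that the $p$-curvature matrix $a(\mathfrak p)$ of $D_{\mathbf a}$ satisfies $a(\mathfrak p)^k=0$. Then the $p$-curvature matrix $mc_\mu(a(\mathfrak p))$ of the convoluted Fuchsian system $D_{mc_\mu(\mathbf a)}$ satisfies $mc_\mu(a(\mathfrak p))^{k+2}=0$.
   Context: $t_1,\dots,t_r\in K$ are fixed pairwise distinct points; for a tuple $\mathbf c=(c_1,\dots,c_r)$ of square matrices over $K$ of equal size, $D_{\mathbf c}$ is the Fuchsian system $Y'=\sum_{i=1}^r\frac{c_i}{x-t_i}Y$. Here $k\ge1$ is an integer. Additive middle convolution: for $\mathbf a=(a_1,\dots,a_r)$, $a_i\in K^{n\times n}$, and $\mu\in K$, let $b_k\in K^{nr\times nr}$ be the block matrix which is zero outside the $k$-th block row and whose $k$-th block row is $(a_1,\dots,a_{k-1},a_k+\mu,a_{k+1},\dots,a_r)$. Let $\mathfrak k=\bigoplus_k\mathfrak k_k$ with $\mathfrak k_k\subset K^{nr}$ the vectors with $k$-th block entry in $\ker(a_k)$ and other entries $0$, and $\mathfrak l=\bigcap_k\ker(b_k)$. Fix an isomorphism $K^{nr}/(\mathfrak k+\mathfrak l)\cong K^m$; $mc_\mu(\mathbf a)=(\tilde b_1,\dots,\tilde b_r)\in(K^{m\times m})^r$, where $\tilde b_k$ is induced by $b_k$. $p$-curvature matrices: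 for a system $D:Y'=aY$ with $a\in K(x)^{n\times n}$, successive differentiation gives systems $Y^{(\ell)}=\widehat{a(\ell)}Y$. For almost all primes the entries of $\widehat{a(p)}$ can be reduced modulo $\mathfrak p$, and the $p$-curvature matrix is $a(\mathfrak p):=\widehat{a(p)}\bmod\mathfrak p$. The $p$-curvature matrix of $D_{mc_\mu(\mathbf a)}$ is denoted $mc_\mu(a(\mathfrak p))$. It is understood that $\mathfrak p$ is such that these reductions are defined: the $t_i$, the entries of the $a_i$ and $\mu$ are $\mathfrak p$-integral, and the isomorphism $K^{nr}/(\mathfrak k+\mathfrak l)\cong K^m$ identifies the image of $\mathcal O_{\mathfrak p}^{nr}$ with $\mathcal O_{\mathfrak p}^m$, where $\mathcal O_{\mathfrak p}\subset K$ is the local ring at $\mathfrak p$ (this excludes only finitely many $\mathfrak p$). *)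

(* Defs.v *)
From HB Require Import structures.
From mathcomp Require Import all_boot all_order all_algebra all_field.
From mathcomp Require Import boolp ring.

Set Implicit Arguments.
Unset Strict Implicit.
Unset Printing Implicit Defensive.

Import GRing.Theory.
Local Open Scope ring_scope.

Section RingOfIntegers.
Variable K : fieldExtType rat.

Definition integral : {pred K} :=
  fun x => `[< integralOver (intr : int -> K) x >].

Fact integral_subring_closed : subring_closed integral.
Proof.
split; first by apply/asboolP; apply: integral1.
- by move=> x y /asboolP hx /asboolP hy; apply/asboolP; apply: integral_sub.
- by move=> x y /asboolP hx /asboolP hy; apply/asboolP; apply: integral_mul.
Qed.

HB.instance Definition _ :=
  GRing.isSubringClosed.Build K integral integral_subring_closed.

Record ringOfIntegers : Type :=
  RingOfIntegers { int_val : K; _ : int_val \in integral }.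

HB.instance Definition _ := [isSub for int_val].
HB.instance Definition _ := [Choice of ringOfIntegers by <:].
HB.instance Definition _ :=
  [SubChoice_isSubComNzRing of ringOfIntegers by <:].
HB.instance Definition _ :=
  GRing.RMorphism.copy int_val (val : ringOfIntegers -> K).

End RingOfIntegers.

Section ResidueRing.
Variables (R : comNzRingType) (P : prime_idealr R).

(* For P a nonzero prime ideal of a ring of integers this is the residue field
   of P, but only the integral domain structure is needed below. *)
Definition residue : Type := {ideal_quot P}.

HB.instance Definition _ := GRing.ComNzRing.on residue.

Definition residue_unit : pred residue :=
  fun x => `[< exists y : residue, y * x = 1 >].

Definition residue_inv (x : residue) : residue :=
  if pselect (exists y : residue, y * x = 1) is left ex
  then projT1 (cid ex) else x.

Fact residue_mulVx : {in residue_unit, left_inverse 1 residue_inv *%R}.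
Proof.
move=> x /asboolP ex; rewrite /residue_inv.
by case: pselect => // ex'; case: (cid ex').
Qed.

Fact residue_unitP (x y : residue) : y * x = 1 -> residue_unit x.
Proof. by move=> yx1; apply/asboolP; exists y. Qed.

Fact residue_inv_out : {in [predC residue_unit], residue_inv =1 id}.
Proof.
move=> x /= /asboolP nex; rewrite /residue_inv.
by case: pselect.
Qed.

HB.instance Definition _ := GRing.ComNzRing_hasMulInverse.Build residue
  residue_mulVx residue_unitP residue_inv_out.

Fact residue_idomain : GRing.integral_domain_axiom residue.
Proof. exact: Quotient.rquot_IdomainAxiom. Qed.

HB.instance Definition _ :=
  GRing.ComUnitRing_isIntegral.Build residue residue_idomain.

Definition residue_map : R -> residue := \pi_({ideal_quot P})%qT.
HB.instance Definition _ := GRing.RMorphism.on residue_map.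

End ResidueRing.

Notation ratfun R := {fraction {poly R}}.
Notation "x %:F" := (@FracField.tofrac _ x).

Section Derivation.
Variable F : fieldType.

(* d/dx on F(x), computed by the quotient rule on the chosen representative;
   [ratfun_derivE] shows that the choice is irrelevant. *)
Definition ratfun_deriv (f : ratfun F) : ratfun F :=
  let q := repr f in
  ((\n_q)^`() * \d_q - \n_q * (\d_q)^`())%:F / (\d_q ^+ 2)%:F.

Fact ratfunE (q : {ratio {poly F}}) :
  \pi_(ratfun F)%qT q = (\n_q)%:F / (\d_q)%:F.
Proof.
have d0 := denom_ratioP q.
apply: (canRL (mulfK _)); first by rewrite tofrac_eq0.
unlock FracField.tofrac; rewrite -[LHS]FracField.pi_mul.
apply/eqmodP; rewrite /= FracField.equivfE /FracField.mulf.
by rewrite !numden_Ratio ?oner_eq0 ?mulf_neq0 ?oner_eq0 // !mulr1 mulrC.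
Qed.

Lemma ratfun_derivE (u v : {poly F}) : v != 0 ->
  ratfun_deriv (u%:F / v%:F) = (u^`() * v - u * v^`())%:F / (v ^+ 2)%:F.
Proof.
move=> v0; rewrite /ratfun_deriv; set q := repr _.
have d0 : \d_q != 0 by exact: denom_ratioP.
have /eqP : u%:F / v%:F = (\n_q)%:F / (\d_q)%:F :> ratfun F.
  by rewrite -[LHS]reprK -/q ratfunE.
rewrite eqr_div ?tofrac_eq0 // -!tofracM tofrac_eq => /eqP e.
have e' := congr1 (@deriv F) e; rewrite !derivM in e'.
apply/eqP; rewrite eqr_div ?tofrac_eq0 ?expf_neq0 // -!tofracM tofrac_eq.
rewrite -subr_eq0; apply/eqP.
transitivity (((\n_q)^`() * v + \n_q * v^`() - (u^`() * \d_q + u * (\d_q)^`()))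
    * \d_q * v - (\n_q * v - u * \d_q) * ((\d_q)^`() * v + \d_q * v^`()));
  first by ring.
by rewrite e e' !subrr !mul0r subrr.
Qed.

(* (linear_system_iter a l) is the matrix a(l) with Y^(l) = a(l) Y for every
   solution of Y' = a Y. *)
Fixpoint linear_system_iter n (a : 'M[ratfun F]_n) (l : nat) :
    'M[ratfun F]_n :=
  if l is l'.+1 then
    map_mx ratfun_deriv (linear_system_iter a l') + linear_system_iter a l' *m a
  else 1%:M.

Definition fuchsian r n (t : 'I_r -> F) (c : 'I_r -> 'M[F]_n) :
    'M[ratfun F]_n :=
  \sum_(i < r) ((('X - (t i)%:P)%:F)^-1 *: map_mx (fun z => (z%:P)%:F) (c i)).

End Derivation.

Section Reduction.
Variables (K : fieldExtType rat) (P : prime_idealr (ringOfIntegers K)).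

Definition local_ring (x : K) : Prop :=
  exists a b : ringOfIntegers K, b \notin P /\ x = int_val a / int_val b.

Definition local_mx m n (M : 'M[K]_(m, n)) : Prop :=
  forall i j, local_ring (M i j).

(* f lies in the localization of O_K[x] at P O_K[x], and g is its image in the
   residue field kappa(x) of that local ring. *)
Definition reduces_to (f : ratfun K) (g : ratfun (residue P)) : Prop :=
  exists u v : {poly ringOfIntegers K},
    [/\ map_poly (residue_map P) v != 0,
        f = (map_poly (@int_val K) u)%:F / (map_poly (@int_val K) v)%:F
      & g = (map_poly (residue_map P) u)%:F / (map_poly (residue_map P) v)%:F].

Lemma reduces_to_inj f g1 g2 : reduces_to f g1 -> reduces_to f g2 -> g1 = g2.
Proof.
have lift0 (w : {poly ringOfIntegers K}) :
    map_poly (residue_map P) w != 0 -> map_poly (@int_val K) w != 0.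
  apply: contra_neq => w0; rewrite (_ : w = 0) ?rmorph0 //.
  apply/polyP => i; apply: val_inj; rewrite coef0 /=.
  by rewrite -(coef_map (@int_val K)) w0 coef0.
move=> [u1 [v1 [v1n0 -> ->]]] [u2 [v2 [v2n0 /eqP e ->]]].
move: e; rewrite eqr_div ?tofrac_eq0 ?lift0 // -!tofracM tofrac_eq.
rewrite -!rmorphM => /eqP e.
have {}e : u1 * v2 = u2 * v1.
  apply/polyP => i; apply: val_inj.
  by have /polyP/(_ i) := e; rewrite !coef_map.
apply/eqP; rewrite eqr_div ?tofrac_eq0 // -!tofracM tofrac_eq.
by rewrite -!rmorphM e.
Qed.

Definition is_pcurvature (p n : nat) (a : 'M[ratfun K]_n)
    (A : 'M[ratfun (residue P)]_n) : Prop :=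
  forall i j, reduces_to (linear_system_iter a p i j) (A i j).

End Reduction.

Section MiddleConvolution.
Variables (F : fieldType) (r n : nat).
Implicit Types (a : 'I_r -> 'M[F]_n) (mu : F).

Local Notation N := (\sum_(i < r) n)%N.

Definition conv_mx mu a (k : 'I_r) : 'M[F]_N :=
  \mxblock_(i < r, j < r)
    (if i == k then a j + (if j == k then mu%:M else 0) else 0 : 'M[F]_n).

Definition block_inj (k : 'I_r) : 'M[F]_(N, n) :=
  \mxcol_(i < r) (if i == k then 1%:M else 0 : 'M[F]_n).

(* Kernels are those of the actions on column vectors. *)
Definition ckernel m q (M : 'M[F]_(m, q)) : {vspace 'cV[F]_q} :=
  lker (linfun (mulmx M)).

Definition mc_k a : {vspace 'cV[F]_N} :=
  (\sum_(k < r) linfun (mulmx (block_inj k)) @: ckernel (a k))%VS.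

Definition mc_l mu a : {vspace 'cV[F]_N} :=
  (\bigcap_(k < r) ckernel (conv_mx mu a k))%VS.

(* pi is the composite F^(nr) ->> F^(nr) / (k + l) ~= F^m, and c is the tuple
   of matrices induced by the (conv_mx mu a k) through that isomorphism. *)
Definition is_mc m mu a (pi : 'M[F]_(m, N)) (c : 'I_r -> 'M[F]_m) : Prop :=
  [/\ limg (linfun (mulmx pi) : 'Hom('cV[F]_N, 'cV[F]_m)) = fullv,
      ckernel pi = (mc_k a + mc_l mu a)%VS
    & forall k, c k *m pi = pi *m conv_mx mu a k].

End MiddleConvolution.

(* Main.v *)
Require Import Defs.
From mathcomp Require Import all_boot all_order all_algebra all_field.
From mathcomp Require Import boolp ring.
Set Implicit Arguments.
Unset Strict Implicit.
Unset Printing Implicit Defensive.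

Import GRing.Theory.
Local Open Scope ring_scope.

(** The convolution (b_1, ..., b_r) of a = (a_1, ..., a_r) before passing to
the quotient by k + l already satisfies the bound, even with exponent k + 1.
Let e_i be the inclusion of the i-th block, s_i = 1 / (x - t_i), and put
  R = (a_1, ..., a_r),  L = sum_i s_i e_i,  D = sum_i s_i e_i e_i^T,
  G(z) = L R + z D.
The coefficient matrix of D_a is R L and that of D_b is G(mu); the latter is a
system in Okubo form, and L' = - D L, R' = 0, D' = - D^2.  Differentiating a
solution of Y' = G(z) Y gives a solution of the system with G(z - 1), so that
Y^(l) = G(z - l + 1) ... G(z - 1) G(z) Y.  If Y' = R L Y, then Z = L Y
satisfies Z' = G(-1) Z and Y' = R Z, whence
  Y^(l + 1) = R G(-l) ... G(-1) L Y.

Modulo a prime above p, a p-integral rational number mu is congruent to an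
integer m with 0 <= m < p, and G(z) only depends on z modulo p.  Therefore both
p-curvatures are built from the cyclic product of the G(j), j in F_p: that of
D_a is R Q L with Q = G(1) ... G(p - 1), and that of D_b is the cyclic product
read from G(m) on,
  G(m + 1) ... G(p - 1) G(0) G(1) ... G(m) = (X L) (R W),
because G(0) = L R; here W X = Q.  Since (R W) (X L) = R Q L is the p-curvature
of D_a, its nilpotence passes to (X L) (R W) at the price of one more factor
([okubo_prod_nilp]).

Finally the projection pi onto K^m intertwines the b_i with the induced
matrices c_i, hence also the systems of all higher derivatives.  The
compatibility of lattices makes pi and a right inverse of it reducible modulo
the prime, so that the p-curvature of D_c is a quotient of the one of D_b. *)

(** * Differentiation of rational functions and of matrices of them *)

Local Notation ratfun_mx := (map_mx (@tofrac _ \o polyC)).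

Section Derivation.
Variable F : fieldType.
Implicit Types f g : ratfun F.

Lemma ratfun_fracP f : exists u v : {poly F}, v != 0 /\ f = u%:F / v%:F.
Proof.
exists (\n_(repr f)), (\d_(repr f)); split; first exact: denom_ratioP.
by rewrite -ratfunE reprK.
Qed.

Lemma ratfun_derivD f g :
  ratfun_deriv (f + g) = ratfun_deriv f + ratfun_deriv g.
Proof.
have [u1 [v1 [n1 ->]]] := ratfun_fracP f.
have [u2 [v2 [n2 ->]]] := ratfun_fracP g.
rewrite addf_div ?tofrac_eq0 // -!tofracM -tofracD.
rewrite !ratfun_derivE ?mulf_neq0 // addf_div ?tofrac_eq0 ?expf_neq0 //.
apply/eqP; rewrite -!tofracM -tofracD.
rewrite eqr_div ?tofrac_eq0 ?mulf_neq0 ?expf_neq0 ?mulf_neq0 //.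
rewrite -!tofracM tofrac_eq derivD !derivM; apply/eqP; ring.
Qed.

Lemma ratfun_derivM f g :
  ratfun_deriv (f * g) = ratfun_deriv f * g + f * ratfun_deriv g.
Proof.
have [u1 [v1 [n1 ->]]] := ratfun_fracP f.
have [u2 [v2 [n2 ->]]] := ratfun_fracP g.
rewrite mulf_div -!tofracM !ratfun_derivE ?mulf_neq0 //.
rewrite !mulf_div -!tofracM addf_div ?tofrac_eq0 ?mulf_neq0 ?expf_neq0 //.
apply/eqP; rewrite -!tofracM -tofracD.
rewrite eqr_div ?tofrac_eq0 ?mulf_neq0 ?expf_neq0 ?mulf_neq0 //.
rewrite -!tofracM tofrac_eq !derivM; apply/eqP; ring.
Qed.

Lemma ratfun_deriv_const (z : F) : ratfun_deriv (z%:P)%:F = 0.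
Proof.
rewrite -[(z%:P)%:F]divr1 -tofrac1 ratfun_derivE ?oner_eq0 // derivC derivE.
by rewrite mul0r mulr0 subrr tofrac0 mul0r.
Qed.

Lemma ratfun_deriv0 : ratfun_deriv 0 = 0 :> ratfun F.
Proof. by have := ratfun_deriv_const 0; rewrite polyC0 tofrac0. Qed.

Lemma ratfun_deriv1 : ratfun_deriv 1 = 0 :> ratfun F.
Proof. by have := ratfun_deriv_const 1; rewrite polyC1 tofrac1. Qed.

Lemma ratfun_derivN f : ratfun_deriv (- f) = - ratfun_deriv f.
Proof. by apply/eqP; rewrite -addr_eq0 -ratfun_derivD addNr ratfun_deriv0. Qed.

Lemma ratfun_deriv_invX (t : F) :
  let s := (('X - t%:P)%:F)^-1 : ratfun F in ratfun_deriv s = - (s * s).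
Proof.
move=> s; rewrite /s -[LHS]/(ratfun_deriv _) -div1r -tofrac1.
rewrite ratfun_derivE ?polyXsubC_eq0 // derivXsubC derivE mul0r sub0r mulr1.
by rewrite tofracN tofrac1 mulNr tofracXn expr2 invfM !mul1r.
Qed.

Definition deriv_mx m n (M : 'M[ratfun F]_(m, n)) := map_mx (@ratfun_deriv F) M.

Lemma deriv_mxD m n (M N : 'M_(m, n)) :
  deriv_mx (M + N) = deriv_mx M + deriv_mx N.
Proof. by apply/matrixP => i j; rewrite !mxE ratfun_derivD. Qed.

Lemma ratfun_deriv_sum I (r : seq I) (P : pred I) (f : I -> ratfun F) :
  ratfun_deriv (\sum_(i <- r | P i) f i)
  = \sum_(i <- r | P i) ratfun_deriv (f i).
Proof. exact: (big_morph _ ratfun_derivD ratfun_deriv0). Qed.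

Lemma deriv_mxM m n q (M : 'M_(m, n)) (N : 'M_(n, q)) :
  deriv_mx (M *m N) = deriv_mx M *m N + M *m deriv_mx N.
Proof.
apply/matrixP => i j; rewrite !mxE ratfun_deriv_sum -big_split /=.
by apply: eq_bigr => k _; rewrite !mxE ratfun_derivM.
Qed.

Lemma deriv_mx_const m n (M : 'M[F]_(m, n)) :
  deriv_mx (ratfun_mx M) = 0.
Proof. by apply/matrixP => i j; rewrite !mxE ratfun_deriv_const. Qed.

Lemma deriv_mx0 m n : deriv_mx (0 : 'M_(m, n)) = 0.
Proof. by apply/matrixP => i j; rewrite !mxE ratfun_deriv0. Qed.

Lemma deriv_mx1 n : deriv_mx (1%:M : 'M_n) = 0.
Proof.
apply/matrixP => i j; rewrite !mxE; case: eqP => _;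
by rewrite ?ratfun_deriv1 ?ratfun_deriv0.
Qed.

Lemma deriv_mxZ m n c (M : 'M_(m, n)) :
  deriv_mx (c *: M) = ratfun_deriv c *: M + c *: deriv_mx M.
Proof. by apply/matrixP => i j; rewrite !mxE ratfun_derivM. Qed.

Lemma deriv_mx_sum m n I (r : seq I) (P : pred I) (f : I -> 'M_(m, n)) :
  deriv_mx (\sum_(i <- r | P i) f i) = \sum_(i <- r | P i) deriv_mx (f i).
Proof. exact: (big_morph _ (@deriv_mxD m n) (@deriv_mx0 m n)). Qed.

End Derivation.

(** * Products of Okubo matrices *)

Section OkuboProducts.
Variables (E : comNzRingType) (N n : nat).
Variables (L : 'M[E]_(N, n)) (R : 'M[E]_(n, N)) (D : 'M[E]_N).

Definition okubo (z : E) : 'M[E]_N := L *m R + z *: D.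

(** The product G(z - l + 1) ... G(z - 1) G(z).  If z' = 0, L' = - D L, R' = 0
and D' = - D^2, it expresses the l-th derivative of the solutions of
Y' = G(z) Y. *)
Fixpoint okubo_prod (z : E) (l : nat) : 'M[E]_N :=
  if l is l'.+1 then okubo (z - l'%:R) *m okubo_prod z l' else 1%:M.

Lemma okubo_prodD z l1 l2 :
  okubo_prod z (l1 + l2) = okubo_prod (z - l1%:R) l2 *m okubo_prod z l1.
Proof.
elim: l2 => [|l IHl]; first by rewrite addn0 mul1mx.
by rewrite addnS /= IHl mulmxA natrD opprD addrA.
Qed.

(** (U V)^(k+1) = U (V U)^k V. *)
Lemma expmx_swap_nilp m q (U : 'M[E]_(m, q)) (V : 'M[E]_(q, m)) k :
  (V *m U) ^+ k = 0 -> (U *m V) ^+ k.+1 = 0.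
Proof.
move=> nil; have comm j : (U *m V) ^+ j *m U = U *m (V *m U) ^+ j.
  elim: j => [|j IHj]; first by rewrite !expr0 mul1mx mulmx1.
  by rewrite !exprSr -!mulmxE -!mulmxA mulmxA IHj !mulmxA.
by rewrite exprSr -mulmxE mulmxA comm nil mulmx0 mul0mx.
Qed.

(** In characteristic p the product over a full period, read from any starting
point m, passes through G(0) = L R, and cutting it there exhibits it as a
product (X L) (R W).  The swapped product (R W) (X L) is R Q L, where
Q = G(1) ... G(p - 1) = G(-(p - 1)) ... G(-1) does not involve m. *)
Lemma okubo_prod_nilp p m k : p%:R = 0 :> E -> (m < p)%N ->
  (R *m okubo_prod (- 1) p.-1 *m L) ^+ k = 0 ->
  (okubo_prod m%:R p) ^+ k.+1 = 0.
Proof.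
move=> p0 ltmp nil.
have predp : -1 = p.-1%:R :> E.
  apply/eqP; rewrite eq_sym -addr_eq0 natr1 prednK ?p0 //.
  exact: leq_ltn_trans ltmp.
pose X := okubo_prod (- 1) (p - m.+1); pose W := okubo_prod m%:R m.
have defp : p.-1 = (p - m.+1 + m)%N.
  by case: p ltmp {p0 nil predp X} => // p ltmp; rewrite subSS subnK.
have -> : okubo_prod m%:R p = (X *m L) *m (R *m W).
  rewrite -(subnKC ltmp) okubo_prodD /= subrr /okubo scale0r addr0.
  by rewrite -natr1 opprD addrA subrr sub0r !mulmxA.
apply: expmx_swap_nilp.
rewrite -mulmxA [W *m _]mulmxA.
suff -> : W *m X = okubo_prod (-1) p.-1 by rewrite mulmxA.
rewrite defp okubo_prodD; congr (okubo_prod _ _ *m _).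
rewrite predp -natrB; last by rewrite defp leq_addr.
by rewrite defp addKn.
Qed.

End OkuboProducts.

(** * Iterated derivatives of Okubo systems *)

Section OkuboSystems.
Variables (F : fieldType) (N n : nat).
Variables (L : 'M[ratfun F]_(N, n)) (R : 'M[ratfun F]_(n, N)).
Variable D : 'M[ratfun F]_N.
Hypotheses (dL : deriv_mx L = - (D *m L)) (dR : deriv_mx R = 0)
  (dD : deriv_mx D = - (D *m D)).

Lemma deriv_okubo z : ratfun_deriv z = 0 ->
  deriv_mx (okubo L R D z) = - (D *m okubo L R D z).
Proof.
move=> dz; rewrite deriv_mxD deriv_mxM deriv_mxZ dL dR dD dz mulmx0 scale0r.
by rewrite addr0 add0r mulmxDr opprD mulmxA mulNmx scalerN -scalemxAr.
Qed.

(** Induction on l: differentiating the leading factor G(z - l) contributes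
- D, by [deriv_okubo], and G(z - l) - D = G(z - l - 1). *)
Lemma deriv_okubo_prod z l : ratfun_deriv z = 0 ->
  deriv_mx (okubo_prod L R D z l) + okubo_prod L R D z l *m okubo L R D z
  = okubo_prod L R D z l.+1.
Proof.
move=> dz; elim: l => [|l IHl].
  by rewrite /= deriv_mx1 add0r mul1mx mulmx1 subr0.
have dzl : ratfun_deriv (z - l%:R) = 0.
  rewrite ratfun_derivD dz ratfun_derivN add0r.
  by rewrite -(rmorph_nat (@tofrac _ \o polyC)) /= ratfun_deriv_const oppr0.
rewrite [in LHS]/= deriv_mxM deriv_okubo // -addrA -mulmxA -mulmxDr IHl.
rewrite /= !mulNmx -!mulmxA -mulNmx -mulmxDl; congr (_ *m _).
have -> : z - l.+1%:R = z - l%:R - 1 by rewrite -natr1 opprD addrA.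
by rewrite /okubo [(_ - 1) *: _]scalerBl scale1r [RHS]addrA [LHS]addrC.
Qed.

Lemma linear_system_iterS q (M : 'M[ratfun F]_q) l :
  linear_system_iter M l.+1
  = deriv_mx (linear_system_iter M l) + linear_system_iter M l *m M.
Proof. by []. Qed.

Lemma okubo_system_iter z l : ratfun_deriv z = 0 ->
  linear_system_iter (okubo L R D z) l = okubo_prod L R D z l.
Proof.
by move=> dz; elim: l => // l IHl; rewrite -deriv_okubo_prod // [LHS]/= IHl.
Qed.

(** If Y' = R L Y, then Z = L Y solves Z' = G(-1) Z, the parameter -1 coming
from L' = - D L. *)
Lemma row_col_system_iter l :
  linear_system_iter (R *m L) l.+1 = R *m okubo_prod L R D (- 1) l *m L.
Proof.
elim: l => [|l IHl].
  by rewrite /= -[map_mx _ _]/(deriv_mx _) deriv_mx1 add0r mul1mx mulmx1.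
rewrite linear_system_iterS IHl !deriv_mxM dR dL mul0mx add0r.
rewrite -deriv_okubo_prod ?ratfun_derivN ?ratfun_deriv1 ?oppr0 //.
rewrite mulmxDr mulmxDl -addrA; congr (_ + _).
rewrite /okubo scaleN1r mulmxBr mulmxBr mulmxBl mulmxN !mulmxA.
by rewrite addrC.
Qed.

End OkuboSystems.

(** * The convolution as an Okubo system *)

Section Convolution.
Variables (F : fieldType) (r n : nat).
Local Notation N := (\sum_(i < r) n)%N.

Lemma tr_block_inj_mul (i j : 'I_r) :
  (block_inj F n i)^T *m block_inj F n j = (if i == j then 1%:M else 0).
Proof.
rewrite tr_mxcol mul_mxrow_mxcol (bigD1 j) //= eqxx mulmx1.
rewrite big1 => [|l /negPf nlj].
  by rewrite addr0 eq_sym; case: eqP; rewrite ?trmx1 ?trmx0.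
by rewrite nlj mulmx0.
Qed.

Lemma mxrow_block_inj (a : 'I_r -> 'M[F]_n) k :
  (\mxrow_j a j) *m block_inj F n k = a k.
Proof.
rewrite mul_mxrow_mxcol (bigD1 k) //= eqxx mulmx1 big1 ?addr0 // => l /negPf ->.
by rewrite mulmx0.
Qed.

Lemma conv_mxE mu (a : 'I_r -> 'M[F]_n) k :
  conv_mx mu a k = block_inj F n k *m (\mxrow_j a j)
    + mu *: (block_inj F n k *m (block_inj F n k)^T).
Proof.
rewrite scalemxAr -mul_scalar_mx tr_mxcol [mu%:M *m _]mul_mxrow.
rewrite -mulmxDr -mxrowD.
rewrite mul_mxcol_mxrow; apply: eq_mxblock => i j.
case: (i == k); last by rewrite mul0mx.
by rewrite mul1mx; case: (j == k); rewrite ?trmx1 ?trmx0 ?mulmx1 ?mulmx0.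
Qed.

Definition conv_col (t : 'I_r -> F) : 'M[ratfun F]_(N, n) :=
  \sum_k (('X - (t k)%:P)%:F)^-1 *: ratfun_mx (block_inj F n k).

Definition conv_row (a : 'I_r -> 'M[F]_n) : 'M[ratfun F]_(n, N) :=
  ratfun_mx (\mxrow_j a j).

Definition conv_diag (t : 'I_r -> F) : 'M[ratfun F]_N :=
  \sum_k (('X - (t k)%:P)%:F)^-1
    *: ratfun_mx (block_inj F n k *m (block_inj F n k)^T).

Lemma fuchsian_conv_row_col t a : fuchsian t a = conv_row a *m conv_col t.
Proof.
rewrite mulmx_sumr; apply: eq_bigr => k _.
by rewrite -scalemxAr -map_mxM mxrow_block_inj.
Qed.

Lemma fuchsian_conv t mu a :
  fuchsian t (conv_mx mu a)
  = okubo (conv_col t) (conv_row a) (conv_diag t) (mu%:P)%:F.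
Proof.
rewrite /okubo mulmx_suml scaler_sumr -big_split; apply: eq_bigr => k _ /=.
rewrite conv_mxE -[map_mx _ (_ + _)]/(ratfun_mx _).
rewrite map_mxD map_mxZ map_mxM scalerDr.
by rewrite -scalemxAl !scalerA [in RHS]mulrC.
Qed.

Lemma conv_diag_inj t k :
  conv_diag t *m ratfun_mx (block_inj F n k)
  = (('X - (t k)%:P)%:F)^-1 *: ratfun_mx (block_inj F n k).
Proof.
rewrite mulmx_suml [LHS](bigD1 k) //= [X in _ + X]big1 => [|i /negPf nik].
  by rewrite addr0 -scalemxAl -map_mxM -mulmxA tr_block_inj_mul eqxx mulmx1.
rewrite -scalemxAl -map_mxM -mulmxA tr_block_inj_mul nik.
by rewrite mulmx0 map_mx0 scaler0.
Qed.

Lemma deriv_conv_col t : deriv_mx (conv_col t) = - (conv_diag t *m conv_col t).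
Proof.
rewrite deriv_mx_sum mulmx_sumr -sumrN; apply: eq_bigr => k _.
rewrite deriv_mxZ ratfun_deriv_invX deriv_mx_const scaler0 addr0.
by rewrite -scalemxAr conv_diag_inj scalerA scaleNr.
Qed.

Lemma deriv_conv_diag t :
  deriv_mx (conv_diag t) = - (conv_diag t *m conv_diag t).
Proof.
rewrite deriv_mx_sum [in RHS]mulmx_sumr -sumrN; apply: eq_bigr => k _.
rewrite deriv_mxZ ratfun_deriv_invX deriv_mx_const scaler0 addr0.
by rewrite -scalemxAr map_mxM mulmxA conv_diag_inj -scalemxAl scalerA scaleNr.
Qed.

Lemma deriv_conv_row a : deriv_mx (conv_row a) = 0.
Proof. exact: deriv_mx_const. Qed.

(** Constant intertwiners commute with differentiation, so they intertwine all
iterates. *)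
Lemma fuchsian_intertwine m q (t : 'I_r -> F) (pi : 'M[F]_(m, q))
    (b : 'I_r -> 'M[F]_q) (c : 'I_r -> 'M[F]_m) l :
  (forall k, c k *m pi = pi *m b k) ->
  linear_system_iter (fuchsian t c) l *m ratfun_mx pi
  = ratfun_mx pi *m linear_system_iter (fuchsian t b) l.
Proof.
move=> cpi.
have base : fuchsian t c *m ratfun_mx pi = ratfun_mx pi *m fuchsian t b.
  rewrite mulmx_suml mulmx_sumr; apply: eq_bigr => k _.
  rewrite -scalemxAl -scalemxAr; congr (_ *: _).
  transitivity (ratfun_mx (c k *m pi)); first by rewrite map_mxM.
  by rewrite cpi map_mxM.
elim: l => [|l IHl]; first by rewrite mul1mx mulmx1.
rewrite !linear_system_iterS mulmxDl mulmxDr -mulmxA base mulmxA IHl -mulmxA.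
congr (_ + _); have := congr1 (@deriv_mx F _ _) IHl.
by rewrite !deriv_mxM deriv_mx_const mulmx0 addr0 mul0mx add0r.
Qed.

End Convolution.

(** * Reduction modulo a prime *)

Section Reduction.
Variables (K : fieldExtType rat) (P : prime_idealr (ringOfIntegers K)).
Local Notation red := (@reduces_to K P).
Local Notation res := (residue_map P).

Lemma residue_map_eq0 x : (res x == 0) = (x \in P).
Proof. by rewrite -[x in RHS]subr0 Quotient.idealrBE -(rmorph0 res). Qed.

Lemma map_residue_neq0 (w : {poly ringOfIntegers K}) :
  map_poly res w != 0 -> map_poly (@int_val K) w != 0.
Proof.
apply: contra_neq => w0; rewrite (_ : w = 0) ?rmorph0 //.
apply/polyP => i; apply: val_inj; rewrite coef0 /=.
by rewrite -(coef_map (@int_val K)) w0 coef0.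
Qed.

Lemma reduces_toD f1 g1 f2 g2 :
  red f1 g1 -> red f2 g2 -> red (f1 + f2) (g1 + g2).
Proof.
move=> [u1 [v1 [n1 -> ->]]] [u2 [v2 [n2 -> ->]]].
exists (u1 * v2 + u2 * v1), (v1 * v2); split.
- by rewrite rmorphM mulf_neq0.
- by rewrite !(rmorphD, rmorphM) /= addf_div ?tofrac_eq0 ?map_residue_neq0.
- by rewrite !(rmorphD, rmorphM) /= addf_div ?tofrac_eq0.
Qed.

Lemma reduces_toM f1 g1 f2 g2 :
  red f1 g1 -> red f2 g2 -> red (f1 * f2) (g1 * g2).
Proof.
move=> [u1 [v1 [n1 -> ->]]] [u2 [v2 [n2 -> ->]]].
exists (u1 * u2), (v1 * v2); split.
- by rewrite rmorphM mulf_neq0.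
- by rewrite !rmorphM /= mulf_div.
- by rewrite !rmorphM /= mulf_div.
Qed.

Lemma reduces_to_poly u :
  red (map_poly (@int_val K) u)%:F (map_poly res u)%:F.
Proof.
by exists u, 1; split; rewrite ?rmorph1 ?oner_eq0 ?divr1.
Qed.

Lemma reduces_to_nat k : red k%:R k%:R.
Proof. by have := reduces_to_poly k%:R; rewrite !rmorph_nat. Qed.

Lemma reduces_toN f g : red f g -> red (- f) (- g).
Proof.
have : red (- 1) (- 1) by have := reduces_to_poly (-1); rewrite !rmorphN1.
by move=> h /(reduces_toM h); rewrite !mulN1r.
Qed.

Lemma reduces_to_const x : local_ring P x -> exists g, red (x%:P)%:F g.
Proof.
move=> [a [b [bP ->]]]; exists ((res a)%:P%:F / (res b)%:P%:F).
have resb : map_poly res b%:P != 0.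
  by rewrite map_polyC polyC_eq0 /= residue_map_eq0.
exists a%:P, b%:P; split; rewrite ?map_polyC //=; first by rewrite -map_polyC.
have := map_residue_neq0 resb; rewrite map_polyC /= polyC_eq0 => b0.
apply: (canRL (mulfK _)); first by rewrite tofrac_eq0 polyC_eq0.
by rewrite -tofracM -polyCM divfK.
Qed.

Lemma reduces_to_invX t : local_ring P t ->
  exists g, red ('X - t%:P)%:F^-1 g.
Proof.
move=> [a [b [bP ->]]].
have resb : map_poly res b%:P != 0.
  by rewrite map_polyC polyC_eq0 /= residue_map_eq0.
have := map_residue_neq0 resb; rewrite map_polyC /= polyC_eq0 => b0.
(* For t = a / b the fraction 1 / ('X - t) is b / (b 'X - a). *)
pose v := b%:P * 'X - a%:P; have vn0 : map_poly res v != 0.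
  rewrite /v rmorphB rmorphM /= map_polyX !map_polyC /=.
  apply: contraNneq bP => /polyP/(_ 1); rewrite coefB coefCM coefX coefC coef0.
  by rewrite mulr1 subr0 => /eqP; rewrite residue_map_eq0.
exists ((map_poly res b%:P)%:F / (map_poly res v)%:F), b%:P, v; split => //.
rewrite -[LHS]div1r -tofrac1; apply/eqP.
rewrite eqr_div ?tofrac_eq0 ?map_residue_neq0 ?polyXsubC_eq0 //.
rewrite -!tofracM tofrac_eq /v rmorphB rmorphM /= map_polyX !map_polyC /= mul1r.
by rewrite mulrBr -polyCM [_ * (_ / _)]mulrC divfK.
Qed.

(** A rational number that is integral at a prime above p reduces into the
prime field F_p: its denominator is a unit modulo p, because numerator and
denominator cannot both vanish in the residue ring. *)
Lemma reduces_to_rat p mu : prime p -> (p%:R : ringOfIntegers K) \in P ->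
    local_ring P (ratr mu) ->
  exists2 m, (m < p)%N & red ((ratr mu)%:P)%:F m%:R.
Proof.
move=> p_pr pP [a [b [bP mub]]].
pose num := numq mu; pose den := denq mu.
have defmu : ratr mu = num%:~R / den%:~R :> K by [].
have den0 : den%:~R != 0 :> K.
  by rewrite -(rmorph_int (in_alg K)) fmorph_eq0 intr_eq0 denq_eq0.
have b0 : int_val b != 0.
  by apply: contraNneq bP => b0; rewrite (_ : b = 0) ?rpred0 //; apply: val_inj.
have num_den : num%:~R * b = a * den%:~R.
  apply: val_inj; rewrite !rmorphM /= !rmorph_int; apply/eqP.
  by rewrite -eqr_div // -mub -defmu.
have resden : res den%:~R != 0.
  apply/negP => /eqP rd0.
  have /eqP := congr1 res num_den.
  rewrite !rmorphM /= rd0 mulr0 mulf_eq0 [res b == 0]residue_map_eq0.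
  rewrite (negPf bP) orbF => /eqP rn0.
  have [u [v uv]] := Bezoutz num den.
  suff : res (u * num + v * den)%:~R = 0.
    have -> : u * num + v * den = 1.
      by rewrite uv; congr Posz; apply/eqP; exact: coprime_num_den.
    by rewrite rmorph1 => /eqP; rewrite oner_eq0.
  by rewrite rmorphD !rmorphM /= rmorphD !rmorphM /= rn0 rd0 !mulr0 addr0.
have resp : res p%:R = 0 by apply/eqP; rewrite residue_map_eq0.
have cop : coprimez den p.
  rewrite coprimezE coprime_sym prime_coprime //; apply: contraNN resden.
  rewrite -dvdzE => /dvdzP[q ->].
  by rewrite intrM rmorphM /= [res p%:~R]resp mulr0.
have [u [v uv]] := Bezoutz den p; rewrite (eqP cop) in uv.
have pgt0 := prime_gt0 p_pr.
pose m := `|(u * num %% p)%Z|%N.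
have mE : m%:Z = (u * num %% p)%Z by rewrite gez0_abs // modz_ge0 // -lt0n.
have numE : num = m%:Z * den + ((u * num %/ p)%Z * den + v * num) * p.
  rewrite -[LHS]mul1r -[X in X * num]uv.
  transitivity (u * num * den + v * num * p); first by ring.
  rewrite [u * num in LHS](divz_eq _ p) -mE; ring.
exists m; first by rewrite -ltz_nat mE ltz_pmod.
exists num%:~R%:P, den%:~R%:P; split.
- by rewrite map_polyC polyC_eq0.
- apply: (canRL (mulfK _)).
    by rewrite tofrac_eq0 map_polyC polyC_eq0 /= rmorph_int.
  rewrite !map_polyC /= -tofracM -polyCM [int_val num%:~R]rmorph_int.
  by rewrite [int_val den%:~R]rmorph_int defmu divfK.
apply: (canRL (mulfK _)); first by rewrite tofrac_eq0 map_polyC polyC_eq0.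
rewrite !map_polyC /= -[m%:R](rmorph_nat (@tofrac _ \o polyC)) /=.
rewrite -tofracM -polyCM.
congr (_%:P%:F); rewrite numE !rmorphD !rmorphM /= !rmorphD !rmorphM /=.
by rewrite [res p%:~R]resp mulr0 addr0 rmorph_nat.
Qed.

Definition reduces_mx m n (A : 'M[ratfun K]_(m, n))
    (B : 'M[ratfun (residue P)]_(m, n)) :=
  forall i j, red (A i j) (B i j).

Lemma reduces_mx_inj m n (A : 'M_(m, n)) B1 B2 :
  reduces_mx A B1 -> reduces_mx A B2 -> B1 = B2.
Proof.
move=> h1 h2; apply/matrixP => i j.
exact: reduces_to_inj (h1 i j) (h2 i j).
Qed.

Lemma reduces_mx_ex m n (A : 'M_(m, n)) :
  (forall i j, exists g, red (A i j) g) -> exists B, reduces_mx A B.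
Proof.
move=> ex.
exists (\matrix_(i, j) projT1 (cid (ex i j))) => i j.
by rewrite mxE; case: cid.
Qed.

Lemma reduces_to_sum I (s : seq I) f g : (forall i, red (f i) (g i)) ->
  red (\sum_(i <- s) f i) (\sum_(i <- s) g i).
Proof.
move=> h; apply: big_ind2 => //; first exact: (reduces_to_nat 0).
by move=> *; apply: reduces_toD.
Qed.

Lemma reduces_mxD m n (A1 A2 : 'M_(m, n)) B1 B2 :
  reduces_mx A1 B1 -> reduces_mx A2 B2 -> reduces_mx (A1 + A2) (B1 + B2).
Proof. by move=> h1 h2 i j; rewrite !mxE; apply: reduces_toD. Qed.

Lemma reduces_mxZ m n c d (A : 'M_(m, n)) B :
  red c d -> reduces_mx A B -> reduces_mx (c *: A) (d *: B).
Proof. by move=> h1 h2 i j; rewrite !mxE; apply: reduces_toM. Qed.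

Lemma reduces_mxM m n q (A1 : 'M_(m, n)) (A2 : 'M_(n, q)) B1 B2 :
  reduces_mx A1 B1 -> reduces_mx A2 B2 -> reduces_mx (A1 *m A2) (B1 *m B2).
Proof.
move=> h1 h2 i j; rewrite !mxE.
by apply: reduces_to_sum => k; apply: reduces_toM.
Qed.

Lemma reduces_mx1 n : reduces_mx (1%:M : 'M_n) 1%:M.
Proof. by move=> i j; rewrite !mxE; apply: reduces_to_nat. Qed.

Lemma reduces_mx_const m n (A : 'M[K]_(m, n)) : local_mx P A ->
  exists B, reduces_mx (ratfun_mx A) B.
Proof.
move=> locA; apply: reduces_mx_ex => i j.
by rewrite mxE; apply: reduces_to_const.
Qed.

Lemma reduces_okubo_prod N n (L : 'M_(N, n)) R D z L' R' D' z' l :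
    reduces_mx L L' -> reduces_mx R R' -> reduces_mx D D' -> red z z' ->
  reduces_mx (okubo_prod L R D z l) (okubo_prod L' R' D' z' l).
Proof.
move=> hL hR hD hz; elim: l => [|l IHl]; first exact: reduces_mx1.
apply: reduces_mxM IHl; apply: reduces_mxD; first exact: reduces_mxM.
apply: reduces_mxZ => //; apply: reduces_toD => //; apply: reduces_toN.
exact: reduces_to_nat.
Qed.

End Reduction.

Arguments reduces_mx {K} P {m n}.

(** * Local matrices and the induced quotient *)

Section LocalMatrices.
Variables (K : fieldExtType rat) (P : prime_idealr (ringOfIntegers K)).

Lemma local_ring_nat k : local_ring P k%:R.
Proof.
exists k%:R, 1; split; last by rewrite rmorph1 divr1 rmorph_nat.
by rewrite idealr1.
Qed.

Lemma local_block_inj r n k : local_mx P (@block_inj K r n k).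
Proof.
move=> i j; rewrite /block_inj mxE; case: (_ == _); rewrite mxE.
  exact: local_ring_nat.
exact: (local_ring_nat 0).
Qed.

Lemma reduces_mx_sum I (s : seq I) m n (A : I -> 'M[ratfun K]_(m, n)) :
  (forall k, exists B, reduces_mx P (A k) B) ->
  exists B, reduces_mx P (\sum_(k <- s) A k) B.
Proof.
move=> h; apply: (big_ind (fun X => exists B, reduces_mx P X B)) => //.
  by exists 0 => i j; rewrite !mxE; apply: (reduces_to_nat P 0).
by move=> X Y [B1 h1] [B2 h2]; exists (B1 + B2); apply: reduces_mxD.
Qed.

Lemma reduces_conv_row r n (a : 'I_r -> 'M[K]_n) :
  (forall i, local_mx P (a i)) -> exists R, reduces_mx P (conv_row a) R.
Proof.
by move=> loca; apply: reduces_mx_const => i j; rewrite mxE; apply: loca.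
Qed.

Lemma reduces_conv_col r n (t : 'I_r -> K) :
  (forall i, local_ring P (t i)) -> exists L, reduces_mx P (conv_col n t) L.
Proof.
move=> loct; apply: reduces_mx_sum => k.
have [s hs] := reduces_to_invX (loct k).
have [e he] := reduces_mx_const (@local_block_inj r n k).
by exists (s *: e); apply: reduces_mxZ.
Qed.

Lemma reduces_conv_diag r n (t : 'I_r -> K) :
  (forall i, local_ring P (t i)) -> exists D, reduces_mx P (conv_diag n t) D.
Proof.
move=> loct; apply: reduces_mx_sum => k.
have [s hs] := reduces_to_invX (loct k).
have [e he] := reduces_mx_const (@local_block_inj r n k).
exists (s *: (e *m e^T)); apply: reduces_mxZ => //.
rewrite map_mxM; apply: reduces_mxM => //.
by move=> i j; rewrite -map_trmx 2!(mxE trmx_key); exact: he.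
Qed.

(** A map carrying the standard lattice onto the standard lattice has a right
inverse over the local ring: lift the basis vectors. *)
Lemma local_surj_split m q (pi : 'M[K]_(m, q)) :
    (forall w : 'cV[K]_m, local_mx P w <->
      exists2 v : 'cV[K]_q, local_mx P v & w = pi *m v) ->
  local_mx P pi /\ exists2 S : 'M[K]_(q, m), local_mx P S & pi *m S = 1%:M.
Proof.
move=> lat.
have local_delta k (j : 'I_k) : local_mx P (delta_mx j 0 : 'cV[K]_k).
  by move=> i l; rewrite mxE; apply: local_ring_nat.
split=> [i j|].
  have /(_ i 0) : local_mx P (pi *m delta_mx j 0 : 'cV_m).
    by apply/lat; exists (delta_mx j 0).
  by rewrite -colE mxE.
have /(_ _)/cid2 sec j := (lat _).1 (local_delta m j).
exists (\matrix_(i, j) s2val (sec j) i 0) => [i j|].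
  by rewrite mxE; apply: (s2valP (sec j)).
apply/matrixP => i j; have /matrixP/(_ i 0) := s2valP' (sec j).
rewrite !mxE andbT => ->; apply: eq_bigr => l _.
by rewrite mxE.
Qed.

End LocalMatrices.

Lemma nilp_quotient (E : pzRingType) m q (pi : 'M[E]_(m, q)) S B C k :
  pi *m S = 1%:M -> C *m pi = pi *m B -> B ^+ k = 0 -> C ^+ k = 0.
Proof.
move=> piS CB Bk.
have comm j : C ^+ j *m pi = pi *m B ^+ j.
  elim: j => [|j IHj]; first by rewrite !expr0 mul1mx mulmx1.
  by rewrite !exprSr -!mulmxE -mulmxA CB mulmxA IHj mulmxA.
by rewrite -[C ^+ k]mulmx1 -piS mulmxA comm Bk mulmx0 mul0mx.
Qed.

(** * Nilpotence of the p-curvature of the middle convolution *)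

Theorem theorem1p4 (K : fieldExtType rat) (p : nat)
    (P : prime_idealr (ringOfIntegers K))
    (r : nat) (t : 'I_r -> K) (n : nat) (a : 'I_r -> 'M[K]_n)
    (mu : rat) (k : nat)
    (m : nat) (pi : 'M[K]_(m, \sum_(i < r) n)) (c : 'I_r -> 'M[K]_m)
    (A : 'M[ratfun (residue P)]_n) :
  prime p -> (p%:R : ringOfIntegers K) \in P ->
  injective t -> (1 <= k)%N ->
  (forall i, local_ring P (t i)) ->
  (forall i, local_mx P (a i)) ->
  local_ring P (ratr mu) ->
  is_mc (ratr mu) a pi c ->
  (forall w : 'cV[K]_m,
     local_mx P w <->
     exists2 v : 'cV[K]_(\sum_(i < r) n), local_mx P v & w = pi *m v) ->
  is_pcurvature p (fuchsian t a) A ->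
  A ^+ k = 0 ->
  exists2 B : 'M[ratfun (residue P)]_m,
    is_pcurvature p (fuchsian t c) B & B ^+ (k + 2) = 0.
Proof.
move=> p_pr pP _ _ loct loca locmu [_ _ c_pi] lattice Acurv Ak.
have [L redL] := reduces_conv_col n loct.
have [R redR] := reduces_conv_row loca.
have [D redD] := reduces_conv_diag n loct.
have [m0 ltm0 redmu] := reduces_to_rat p_pr pP locmu.
have [locpi [S locS piS]] := local_surj_split lattice.
have [pi' redpi] := reduces_mx_const locpi.
have [S' redS] := reduces_mx_const locS.
have derivs := (deriv_conv_col n t, deriv_conv_row a, deriv_conv_diag n t).
pose B := okubo_prod L R D m0%:R p.
have redB : reduces_mx P
    (linear_system_iter (fuchsian t (conv_mx (ratr mu) a)) p) B.
  rewrite fuchsian_conv okubo_system_iter ?derivs ?ratfun_deriv_const //.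
  exact: reduces_okubo_prod.
have AE : A = R *m okubo_prod L R D (- 1) p.-1 *m L.
  apply: (reduces_mx_inj Acurv).
  rewrite fuchsian_conv_row_col -(prednK (prime_gt0 p_pr)).
  rewrite (@row_col_system_iter _ _ _ _ _ (conv_diag n t)) ?derivs //.
  do 2![apply: reduces_mxM => //].
  by apply: reduces_okubo_prod => //; apply: reduces_toN (reduces_to_nat P 1).
have p0 : p%:R = 0 :> ratfun (residue P).
  have resp : residue_map P p%:R = 0 by apply/eqP; rewrite residue_map_eq0.
  pose toratfun := @tofrac {poly residue P} \o polyC \o residue_map P.
  rewrite -[p%:R](rmorph_nat toratfun) /toratfun /=.
  by rewrite resp polyC0 tofrac0.
have nilB : B ^+ (k + 2) = 0.
  rewrite addn2 exprS.
  by rewrite (@okubo_prod_nilp _ _ _ L R D p m0 k) ?mulr0 // -AE.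
have piS' : pi' *m S' = 1%:M.
  apply: (reduces_mx_inj _ (@reduces_mx1 K P m)).
  by have := reduces_mxM redpi redS; rewrite -map_mxM piS map_mx1.
have intertwine := fuchsian_intertwine t p c_pi.
have redC : reduces_mx P (linear_system_iter (fuchsian t c) p) (pi' *m B *m S').
  rewrite -[linear_system_iter _ p]mulmx1.
  rewrite -(map_mx1 (@tofrac _ \o polyC)) -piS map_mxM mulmxA intertwine.
  by do 2![apply: reduces_mxM => //].
exists (pi' *m B *m S') => //.
apply: nilp_quotient piS' _ nilB.
apply: (reduces_mx_inj (reduces_mxM redC redpi)).
by rewrite intertwine; apply: reduces_mxM.
Qed.
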